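(* Let $d\ge2$, let $\mathcal L\subset\mathbb R^d$ be a unimodular lattice and let $\vec\alpha\in\mathbb R^d$ be badly approximable by $\mathbb Q\mathcal L$. For every $\mathcal D\subseteq\mathbb S_1^{d-1}$ with non-empty interior, $$\sup_{N\in\mathbb N} g_N(\mathcal D,\vec\alpha,\mathcal L)<\infty.$$
   Context: $\mathbb S_1^{d-1}$ is the unit sphere in $\mathbb R^d$. A unimodular lattice is a lattice of covolume $1$. $\vec\alpha$ is badly approximable by $\mathbb Q\mathcal L$ if there is $c>0$ with $|n\vec\alpha-\vec\ell|_\infty>c\,n^{-1/d}$ for all $\vec\ell\in\mathcal L$ and $n\in\mathbb N$ ($|\cdot|_\infty$ the maximum norm). For $\mathcal D\subseteq\mathbb S_1^{d-1}$ and $1\le n\le N$, let $$\delta_{n,N}(\mathcal D)=\min\{|(m-n)\vec\alpha+\vec\ell| : (m-n)\vec\alpha+\vec\ell\in\mathbb R_{>0}\mathcal D,\ 1\le m\le N,\ \vec\ell\in\mathcal L\}$$ (Euclidean norm) and $g_N(\mathcal D,\vec\alpha,\mathcal L)=|\{\delta_{n,N}(\mathcal D):1\le n\le N\}|$. *)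

(* Defs.v *)
From HB Require Import structures.
From mathcomp Require Import all_boot all_order all_algebra.
From mathcomp Require Import all_classical all_reals all_analysis.
Set Implicit Arguments. Unset Strict Implicit. Unset Printing Implicit Defensive.
Import Order.TTheory GRing.Theory Num.Theory.
Local Open Scope classical_set_scope.
Local Open Scope ring_scope.

Section Defs.
Variables (R : realType) (d : nat).

Definition eucl_norm (v : 'rV[R]_d) : R := Num.sqrt (\sum_(i < d) v ord0 i ^+ 2).

Definition max_norm (v : 'rV[R]_d) : R := \big[Num.max/0]_(i < d) `|v ord0 i|.

Definition lattice_of (B : 'M[R]_d) : set 'rV[R]_d :=
  [set x | exists k : 'rV[int]_d, x = map_mx (fun z : int => z%:~R) k *m B].

Definition unimodular (B : 'M[R]_d) : Prop := `|\det B| = 1.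

Definition unit_sphere : set 'rV[R]_d := [set v | eucl_norm v = 1].

Definition nonempty_interior_in_sphere (D : set 'rV[R]_d) : Prop :=
  exists u : 'rV[R]_d, exists e : R, 0 < e /\ unit_sphere u /\
    forall v, unit_sphere v -> eucl_norm (v - u) < e -> D v.

Definition pos_cone (D : set 'rV[R]_d) : set 'rV[R]_d :=
  [set w | exists t : R, 0 < t /\ exists v, D v /\ w = t *: v].

Definition badly_approximable (B : 'M[R]_d) (alpha : 'rV[R]_d) : Prop :=
  exists c : R, 0 < c /\ forall n : nat, (0 < n)%N -> forall l, lattice_of B l ->
    c * powR (n%:R) (- (d%:R)^-1) < max_norm (n%:R *: alpha - l).

Definition delta_set (B : 'M[R]_d) (alpha : 'rV[R]_d) (D : set 'rV[R]_d)
    (n N : nat) : set R :=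
  [set r | exists m : nat, exists l : 'rV[R]_d,
     [/\ (1 <= m <= N)%N, lattice_of B l,
         pos_cone D ((m%:R - n%:R) *: alpha + l) &
         r = eucl_norm ((m%:R - n%:R) *: alpha + l)]].

(* delta_{n,N}(D): the minimum (= infimum, which is attained) of delta_set *)
Definition delta (B : 'M[R]_d) (alpha : 'rV[R]_d) (D : set 'rV[R]_d) (n N : nat) : R :=
  inf (delta_set B alpha D n N).

Definition gN (B : 'M[R]_d) (alpha : 'rV[R]_d) (D : set 'rV[R]_d) (N : nat) : nat :=
  size (undup [seq delta B alpha D n N | n <- iota 1 N]).

End Defs.

(* Main.v *)
(** The differences k alpha + l with |k| <= N are, by bad approximability,
    separated at scale N^(-1/d), so only boundedly many of them have norm
    O(N^(-1/d)); hence it suffices to bound every delta_(n,N) by O(N^(-1/d)).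
    For this, the lattice of all (k, k alpha + l) in R^(d+1), rescaled to
    (k / h^d, h (k alpha + l)), has no short vectors.  By the pigeonhole
    principle a large box of size T contains at least T^(d+1) lattice points,
    while a hyperplane meets it in O(T^d) separated points only; so a box of
    bounded size contains a basis of R^(d+1), and the covering radius is
    bounded.  Applied to a ball in the cone over D (and to both alpha and
    -alpha, as only one of the ranges n + k <= N and n - k >= 1 need be long)
    this gives the bound on delta_(n,N). *)

Require Import Defs.
From HB Require Import structures.
From mathcomp Require Import all_boot all_order all_algebra.
From mathcomp Require Import all_classical all_reals all_analysis.
From mathcomp Require Import ring lra zify.
Import Order.TTheory GRing.Theory Num.Theory.
Local Open Scope classical_set_scope.
Local Open Scope ring_scope.

Set Implicit Arguments.
Unset Strict Implicit.

(** * Packing bounds for separated points in a cube and on a hyperplane *)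

Lemma truncn_eq_dist (R : realType) (x y : R) :
  0 <= x -> 0 <= y -> Num.truncn x = Num.truncn y -> `|x - y| < 1.
Proof.
move=> x0 y0 xy; have /andP[x1 x2] := truncn_itv x0.
have /andP[y1 y2] := truncn_itv y0; rewrite xy -natr1 in x1 x2.
rewrite -natr1 in y2; rewrite ltr_norml; apply/andP; split; lra.
Qed.

Lemma cover_injective_code (T : choiceType) (x0 : T) (I : finType) (X : set T)
    (code : T -> I) :
  (forall t t', X t -> X t' -> code t = code t' -> t = t') ->
  exists2 s : seq T, (size s <= #|I|)%N & forall t, X t -> t \in s.
Proof.
(* One preimage is chosen per code; [x0] stands in for codes that no point of [X] has. *)
move=> inj; pose pick i := xget x0 (X `&` [set t | code t = i]).
exists [seq pick i | i <- enum I]; first by rewrite size_map -cardE.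
move=> t Xt; apply/mapP; exists (code t); first by rewrite mem_enum.
have [Xp cp] : (X `&` [set t' | code t' = code t]) (pick (code t)).
  exact: (xgetI x0 (x := t)).
by apply: inj => //; rewrite cp.
Qed.

(** Cut the cube of half-side [r] into boxes of side [s]: two points of [X] whose images share a box
    have all coordinates within [s], so they coincide. Shifting by [r] makes the box numbers
    natural. *)
Lemma packing (R : realType) (n : nat) (T : choiceType) (x0 : T) (X : set T)
    (f : T -> 'rV[R]_n) (r s : R) :
  0 < s ->
  (forall t i, X t -> `|f t ord0 i| <= r) ->
  (forall t t', X t -> X t' ->
     (forall i, `|f t ord0 i - f t' ord0 i| < s) -> t = t') ->
  exists2 l : seq T, (size l <= (Num.truncn (2 * r / s)).+1 ^ n)%N &
    forall t, X t -> t \in l.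
Proof.
move=> s0 bnd sep; set P := Num.truncn _.
pose code t : {ffun 'I_n -> 'I_P.+1} :=
  [ffun i => inord (Num.truncn ((f t ord0 i + r) / s))].
have code_ge0 t i : X t -> 0 <= (f t ord0 i + r) / s.
  move=> /(bnd _ i); rewrite ler_norml => /andP[h _].
  by apply: divr_ge0; [lra | exact: ltW].
have codeE t i : X t -> (code t i : nat) = Num.truncn ((f t ord0 i + r) / s).
  move=> Xt; rewrite ffunE inordK// ltnS; apply: le_truncn.
  rewrite ler_pM2r ?invr_gt0//.
  by have := bnd _ i Xt; rewrite ler_norml => /andP[_]; lra.
have [|l] := @cover_injective_code _ x0 _ X code.
  move=> t t' Xt Xt' ct; apply: sep => // i.
  have := codeE _ i Xt; rewrite ct codeE// => e.
  have := @truncn_eq_dist _ _ _ (code_ge0 _ i Xt) (code_ge0 _ i Xt') (esym e).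
  rewrite -mulrBl (_ : _ - _ = f t ord0 i - f t' ord0 i); last by ring.
  by rewrite normrM normfV (gtr0_norm s0) ltr_pdivrMr// mul1r.
by rewrite card_ffun !card_ord => ? ?; exists l.
Qed.

Lemma mulmx_entry_le (R : realType) (m n : nat) (v : 'rV[R]_m) (A : 'M[R]_(m, n))
    (b : R) :
  (forall i, `|v ord0 i| <= b) ->
  forall j, `|(v *m A) ord0 j| <= b * \sum_i \sum_k `|A i k|.
Proof.
move=> vb j; rewrite mxE (le_trans (ler_norm_sum _ _ _))// mulr_sumr.
apply: ler_sum => i _; rewrite normrM ler_pM//.
by rewrite (bigD1 j)//= lerDl sumr_ge0.
Qed.

(* On a hyperplane [\sum_i a_i w_i = 0], the coordinate with the largest [|a_j|]
   is a [d]-Lipschitz function of the others, so forgetting it keeps the points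
   separated. *)
Lemma separated_rank_deficient (R : realType) (d p : nat) (W : 'M[R]_(p, d.+1))
    (r s : R) :
  0 < s -> (forall k i, `|W k i| <= r) ->
  (forall k k', (forall i, `|W k i - W k' i| < s) -> k = k') ->
  ~~ row_full W -> (p <= (Num.truncn (2 * r / (s / d.+1%:R))).+1 ^ d)%N.
Proof.
move=> s0 bnd sep; rewrite -cokermx_eq0 => /eqP coker.
case: p W bnd sep coker => [//|p] W bnd sep coker.
(* A nonzero column of the cokernel is the normal of a hyperplane containing all rows of [W]. *)
have [a Wa a0] : exists2 a : 'I_d.+1 -> R,
    (forall k, \sum_i W k i * a i = 0) & exists i, a i != 0.
  have [i [j ij]] : exists i j, cokermx W i j != 0.
    apply: contrapT => h; apply: coker; apply/matrixP => i j; rewrite [RHS]mxE.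
    by apply/eqP/negPn/negP => ij; apply: h; exists i, j.
  exists (fun i => cokermx W i j); last by exists i.
  move=> k; have /matrixP/(_ k j) := mulmx_coker W.
    by rewrite mxE [RHS]mxE.
have [i0 ai0] := a0.
have [j aj jmax] : exists2 j, a j != 0 & forall i, `|a i| <= `|a j|.
  have [j _ jmax] := Order.TotalTheory.arg_maxP (fun i => `|a i|) (isT : xpredT i0).
  exists j => [|i]; last exact: jmax.
  by rewrite -normr_gt0 (lt_le_trans _ (jmax i0 isT))// normr_gt0.
have [|||l sl ml] := @packing R d 'I_p.+1 ord0 setT (fun k => \row_i W k (lift j i))
   r (s / d.+1%:R).
- by rewrite divr_gt0.
- by move=> k i _; rewrite mxE.
- move=> k k' _ _ h.
  have d1 : (d.+1%:R : R) != 0 by rewrite pnatr_eq0.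
  have sd : s / d.+1%:R <= s by rewrite ler_pdivrMr// -[leLHS]mulr1 ler_pM2l// ler1n.
  apply: sep => i; have [i' ->|->] := unliftP j i.
    by have := h i'; rewrite !mxE => /lt_le_trans; apply.
  have -> : W k j - W k' j =
      - \sum_(i < d) (W k (lift j i) - W k' (lift j i)) * (a (lift j i) / a j).
    have := Wa k'; have := Wa k; rewrite !(bigD1_ord j)//=.
    move=> /(canRL (addrK _)); rewrite sub0r => e1.
    move=> /(canRL (addrK _)); rewrite sub0r => e2.
    apply: (mulIf aj); rewrite mulrBl e1 e2 mulNr mulr_suml -opprD -sumrN.
    rewrite -big_split/=; congr (- _); apply: eq_bigr => i' _.
    by rewrite -mulrA divfK// mulrBl.
  (* The quotients [a_i / a_j] are at most 1 in absolute value, and [d] terms of size at most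
     [s / d.+1] sum to less than [s]; this fixes the scale used in the packing. *)
  rewrite normrN (le_lt_trans (ler_norm_sum _ _ _))//.
  apply: (@le_lt_trans _ _ (\sum_(i < d) s / d.+1%:R)).
    apply: ler_sum => i' _; rewrite normrM -[leRHS]mulr1 ler_pM//.
      by have := h i'; rewrite !mxE => /ltW.
    by rewrite normrM normfV ler_pdivrMr ?normr_gt0// mul1r.
  rewrite sumr_const card_ord -[_ *+ d]mulr_natl mulrCA -[ltRHS]mulr1 ltr_pM2l//.
  by rewrite ltr_pdivrMr// mul1r ltr_nat.
apply: leq_trans sl; rewrite -[leqLHS]card_ord cardE.
by apply: uniq_leq_size (enum_uniq _) _ => k _; exact: ml.
Qed.

(** * Lattice operations and the covering radius *)

Lemma lattice_ofD (R : realType) (n : nat) (G : 'M[R]_n) (x y : 'rV[R]_n) :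
  lattice_of G x -> lattice_of G y -> lattice_of G (x + y).
Proof.
move=> [k ->] [l ->]; exists (k + l); rewrite -mulmxDl; congr (_ *m _).
by apply/rowP => i; rewrite !mxE intrD.
Qed.

Lemma lattice_ofN (R : realType) (n : nat) (G : 'M[R]_n) (x : 'rV[R]_n) :
  lattice_of G x -> lattice_of G (- x).
Proof.
move=> [k ->]; exists (- k); rewrite -mulNmx; congr (_ *m _).
by apply/rowP => i; rewrite !mxE intrN.
Qed.

Lemma lattice_ofZ (R : realType) (n : nat) (G : 'M[R]_n) (z : int) (x : 'rV[R]_n) :
  lattice_of G x -> lattice_of G (z%:~R *: x).
Proof.
move=> [k ->]; exists (z *: k); rewrite scalemxAl; congr (_ *m _).
by apply/rowP => i; rewrite !mxE intrM.
Qed.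

Lemma lattice_of0 (R : realType) (n : nat) (G : 'M[R]_n) : lattice_of G 0.
Proof. by exists 0; rewrite map_mx0 ?mul0mx. Qed.

(** Some [n] rows of [W] form a basis of the space. Rounding down the coordinates of [x] in it
    leaves [n] coefficients in [0, 1), each multiplying entries of size at most [r]. *)
Lemma lattice_covering (R : realType) (n p : nat) (G : 'M[R]_n) (W : 'M[R]_(p, n))
    (r : R) :
  (forall k, lattice_of G (row k W)) -> (forall k i, `|W k i| <= r) ->
  row_full W ->
  forall x : 'rV[R]_n, exists2 y, lattice_of G y &
    forall i, `|(y - x) ord0 i| <= n%:R * r.
Proof.
move=> WG Wr full x; pose f := fullrankfun full.
have [t ->] : exists t, x = t *m rowsub f W.
  by exists (x *m invmx (rowsub f W)); rewrite mulmxKV// fullrowsub_unit.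
pose k := map_mx (fun u : R => Num.floor u) t.
pose y := map_mx (fun z : int => z%:~R : R) k *m rowsub f W.
exists y.
  rewrite /y mulmx_sum_row; elim/big_ind: _ => [|u v|i _].
  - exact: lattice_of0.
  - exact: lattice_ofD.
  - by rewrite mxE; apply: lattice_ofZ; rewrite row_rowsub.
move=> i; rewrite -mulmxBl mxE (le_trans (ler_norm_sum _ _ _))//.
apply: (@le_trans _ _ (\sum_(j < n) r)); last first.
  by rewrite sumr_const card_ord mulr_natl.
apply: ler_sum => j _; rewrite normrM -[leRHS]mul1r ler_pM//; last by rewrite mxE.
rewrite !mxE distrC.
have /andP[h1 h2] := floor_itv (t ord0 j); rewrite intrD in h2.
by rewrite ger0_norm; lra.
Qed.

(** * Bad approximability as separation of returns *)

Lemma max_norm_gt (R : realType) (n : nat) (v : 'rV[R]_n) (a : R) :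
  0 <= a -> a < max_norm v -> exists i, a < `|v ord0 i|.
Proof.
move=> a0 av; apply: contrapT => h; move: av; apply/negP; rewrite -leNgt.
apply: bigmax_le => // i _; rewrite leNgt; apply/negP => ai.
by apply: h; exists i.
Qed.

Lemma unimodular_unit (R : realType) (d : nat) (B : 'M[R]_d) :
  unimodular B -> B \in unitmx.
Proof. by move=> B1; rewrite unitmxE unitfE -normr_gt0 B1. Qed.

Lemma int_lt1_eq0 (R : realType) (z : int) : `|z%:~R : R| < 1 -> z = 0.
Proof. by rewrite -intr_norm -[1]/(1%:~R) ltr_int => ?; lia. Qed.

(** If 0 < |k| <= h^d then |k|^(-1/d) >= 1/h, so the hypothesis on [alpha] applies, up to a sign
    when [k] is negative. If k = 0, the vector is a nonzero point of the lattice, which is bounded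
    away from 0 in terms of the inverse of [B]. *)
Lemma badly_approximable_separated (R : realType) (d : nat) (B : 'M[R]_d)
    (alpha : 'rV[R]_d) :
  (0 < d)%N -> unimodular B -> badly_approximable B alpha ->
  exists c : R, [/\ 0 < c, c <= 1 & forall (h : nat) (k : int) (l : 'rV[R]_d),
    (0 < h)%N -> (`|k| <= h ^ d)%N -> lattice_of B l -> (k = 0 -> l != 0) ->
    exists i, c / h%:R <= `|(k%:~R *: alpha + l) ord0 i|].
Proof.
move=> d0 uB [c0 [c0_gt0 bad]].
(* The summand 1 makes [b] positive and the final estimate of the case k = 0 strict. *)
pose b : R := 1 + \sum_i \sum_k `|invmx B i k|.
have b0 : 0 < b by rewrite ltr_pwDl// sumr_ge0// => i _; rewrite sumr_ge0.
pose c := Num.min 1 (Num.min c0 b^-1).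
have cc0 : c <= c0 by rewrite /c !ge_min lexx !orbT.
have cb : c <= b^-1 by rewrite /c !ge_min lexx !orbT.
have c_gt0 : 0 < c by rewrite !lt_min ltr01 c0_gt0 invr_gt0.
exists c; split => //; first by rewrite ge_min lexx.
move=> h k l h0 kh Ll kl.
have bad' n : (0 < n)%N -> (n <= h ^ d)%N -> forall l', lattice_of B l' ->
    exists i, c / h%:R <= `|(n%:R *: alpha - l') ord0 i|.
  move=> n0 nh l' /(bad _ n0) lt.
  have [|i ilt] := max_norm_gt _ lt.
    by rewrite mulr_ge0 ?powR_ge0// ltW.
  exists i; apply: ltW; apply: le_lt_trans ilt; apply: ler_pM => //.
    exact: ltW.
  rewrite powRN lef_pV2 ?posrE ?ltr0n ?powR_gt0 ?ltr0n//.
  have -> : h%:R = ((h ^ d)%N%:R) `^ d%:R^-1 :> R.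
    rewrite natrX -powR_mulrn// -powRrM mulfV ?powRr1//.
    by rewrite pnatr_eq0 -lt0n.
  by apply: ge0_ler_powR; rewrite ?nnegrE ?invr_ge0// ler_nat.
case: k kh kl => [[|n]|n] kh kl.
- rewrite scale0r add0r; have /negP l0 := kl erefl.
  apply: contrapT => hl; apply: l0; have [z lz] := Ll.
  suff z0 : z = 0 by rewrite lz z0 map_mx0 ?mul0mx.
  apply/rowP => j; rewrite [RHS]mxE; apply: (int_lt1_eq0 (R := R)).
  (* The integer coordinates of [l] in the basis [B] are below 1 in absolute value when all entries
     of [l] are small. *)
  have -> : (z ord0 j)%:~R = (l *m invmx B) ord0 j :> R.
    by rewrite lz mulmxK ?unimodular_unit// mxE.
  have := @mulmx_entry_le _ _ _ l (invmx B) b^-1.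
  move=> /(_ _ j) => /(_ _)/le_lt_trans; apply.
    move=> i; apply: (@le_trans _ _ (c / h%:R)); last first.
      rewrite ler_pdivrMr ?ltr0n// (le_trans cb)//.
      by rewrite -[leLHS]mulr1 ler_pM2l ?invr_gt0// ler1n.
    rewrite leNgt; apply/negP => lt; apply: hl; exists i; exact: ltW.
  by rewrite mulrC ltr_pdivrMr// mul1r /b ltrDr.
- have [i hi] := bad' n.+1 isT kh (- l) (lattice_ofN Ll).
  by exists i; move: hi; rewrite opprK.
- have [i hi] := bad' n.+1 isT kh l Ll.
  exists i; move: hi; rewrite NegzE.
  by rewrite -normrN; congr (_ <= `|_|); rewrite !mxE mulrNz; ring.
Qed.

(** * Close returns by pigeonhole, and the rescaled lattice *)

Lemma pigeonhole_fiber (I J : finType) (f : I -> J) (M : nat) :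
  (M * #|J| < #|I|)%N -> exists j, (M < #|[pred i | f i == j]|)%N.
Proof.
move=> MJ; apply: contrapT => h; move: MJ; apply/negP; rewrite -leqNgt.
rewrite -[#|I|]sum1_card (partition_big f xpredT)//= mulnC -sum_nat_const.
apply: leq_sum => j _; rewrite sum1_card leqNgt; apply/negP => lt.
by apply: h; exists j.
Qed.

(** Dirichlet's argument: modulo the lattice, the M g^d + 1 multiples of [alpha] fall into g^d boxes
    of side 1/g in the coordinates of [B], so some box receives M + 1 of them. *)
Lemma many_close_returns (R : realType) (d : nat) (B : 'M[R]_d)
    (alpha : 'rV[R]_d) (g M : nat) :
  unimodular B -> (0 < g)%N ->
  exists (k : 'I_M.+1 -> int) (l : 'I_M.+1 -> 'rV[R]_d), injective k /\
    forall a, [/\ (`|k a| <= M * g ^ d)%N, lattice_of B (l a) &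
      forall i, `|((k a)%:~R *: alpha + l a) ord0 i| <=
        g%:R^-1 * \sum_i \sum_j `|B i j|].
Proof.
case: g => [//|g] uB _; have uB' := unimodular_unit uB.
pose y (k : nat) : 'rV[R]_d := k%:R *: (alpha *m invmx B).
pose fl (k : nat) : 'rV[int]_d := \row_i Num.floor (y k ord0 i).
pose fr (k : nat) : 'rV[R]_d := \row_i (y k ord0 i - (fl k ord0 i)%:~R).
have fr_itv k i : 0 <= fr k ord0 i < 1.
  rewrite !mxE; have /andP[] := floor_itv ((k%:R *: (alpha *m invmx B)) ord0 i).
  rewrite intrD !mxE; lra.
have frE k : fr k *m B = k%:R *: alpha - map_mx (fun z : int => z%:~R) (fl k) *m B.
  have -> : fr k = y k - map_mx (fun z : int => z%:~R) (fl k).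
    by apply/rowP => i; rewrite [LHS]mxE [RHS]mxE; congr (_ + _); rewrite !mxE.
  by rewrite mulmxBl -scalemxAl mulmxKV.
pose code (k : 'I_(M * g.+1 ^ d).+1) : {ffun 'I_d -> 'I_g.+1} :=
  [ffun i => inord (Num.truncn (g.+1%:R * fr k ord0 i))].
have codeE k i : (code k i : nat) = Num.truncn (g.+1%:R * fr k ord0 i).
  have /andP[f0 f1] := fr_itv k i.
  rewrite ffunE inordK// truncn_lt_nat ?mulr_ge0//.
  by rewrite -[ltRHS]mulr1 ltr_pM2l ?ltr0n.
have [|j ltj] := @pigeonhole_fiber _ _ code M.
  by rewrite card_ffun !card_ord.
pose e (a : 'I_M.+1) : 'I_(M * g.+1 ^ d).+1 := enum_val (widen_ord ltj a).
have e_inj : injective e.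
  by move=> a b /enum_val_inj /(congr1 val) /= /val_inj.
have ecode a : code (e a) = j by have := enum_valP (widen_ord ltj a); rewrite inE => /eqP.
(* Subtracting one fixed member of the box keeps the multipliers distinct; the index [ord0] itself
   gives the multiplier 0. *)
exists (fun a => (e a)%:Z - (e ord0)%:Z).
exists (fun a => map_mx (fun z : int => z%:~R) (fl (e ord0) - fl (e a)) *m B).
split=> [a b /addIr[/val_inj/e_inj//]|a]; split.
- by have := ltn_ord (e a); have := ltn_ord (e ord0); lia.
- by exists (fl (e ord0) - fl (e a)).
have -> : ((e a)%:Z - (e ord0)%:Z)%:~R *: alpha +
    map_mx (fun z : int => z%:~R) (fl (e ord0) - fl (e a)) *m B =
    (fr (e a) - fr (e ord0)) *m B.
  rewrite mulmxBl !frE rmorphB/= scalerBl.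
  have -> : map_mx (fun z : int => z%:~R : R) (fl (e ord0) - fl (e a)) =
    map_mx (fun z : int => z%:~R) (fl (e ord0)) -
    map_mx (fun z : int => z%:~R) (fl (e a)).
    by apply/rowP => i; rewrite !mxE rmorphB.
  by rewrite mulmxBl opprB addrACA [in RHS]addrACA; congr (_ + _); rewrite addrC.
move=> i; apply: mulmx_entry_le => {}i.
have g0 : 0 < g.+1%:R :> R by rewrite ltr0n.
have := @truncn_eq_dist R (g.+1%:R * fr (e a) ord0 i) (g.+1%:R * fr (e ord0) ord0 i).
have /andP[f0 _] := fr_itv (e a) i; have /andP[f0' _] := fr_itv (e ord0) i.
rewrite !mulr_ge0// -!codeE !ecode => /(_ isT isT erefl).
rewrite -mulrBr normrM (gtr0_norm g0) => lt.
rewrite -[leRHS]mul1r ler_pdivlMr// mulrC ltW//.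
by move: lt; congr (_ * `|_| < _); rewrite [RHS]mxE; congr (_ + _); rewrite [RHS]mxE.
Qed.

(* Its lattice consists of the vectors [(k / h ^ d, h (k alpha + l))], so that
   bad approximability says precisely that it has no short vector. *)
Definition flow_mx (R : realType) (d : nat) (B : 'M[R]_d) (alpha : 'rV[R]_d)
    (h : nat) : 'M[R]_(1 + d) :=
  block_mx (h%:R ^- d)%:M (h%:R *: alpha) 0 (h%:R *: B).

Lemma lattice_of_flow (R : realType) (d : nat) (B : 'M[R]_d)
    (alpha : 'rV[R]_d) (h : nat) (w : 'rV[R]_(1 + d)) :
  lattice_of (flow_mx B alpha h) w <->
  exists (k : int) (l : 'rV[R]_d), lattice_of B l /\
    w = row_mx (k%:~R * h%:R ^- d)%:M (h%:R *: (k%:~R *: alpha + l)).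
Proof.
have E (k : int) (z : 'rV[int]_d) :
    map_mx (fun z : int => z%:~R) (row_mx k%:M z) *m flow_mx B alpha h =
    row_mx (k%:~R * h%:R ^- d)%:M
      (h%:R *: (k%:~R *: alpha + map_mx (fun z : int => z%:~R) z *m B)).
  rewrite map_row_mx /flow_mx mul_row_block mulmx0 addr0.
  have -> : map_mx (fun z : int => z%:~R : R) k%:M = k%:~R%:M :> 'M[R]_1.
    by apply/matrixP => i j; rewrite !mxE !ord1.
  rewrite -scalar_mxM mul_scalar_mx -scalemxAr scalerDr !scalerA.
  by rewrite [h%:R * _]mulrC.
split=> [[z ->]|[k [l [[z ->] ->]]]].
  rewrite -[z]hsubmxK [lsubmx z]mx11_scalar E.
  by do 2 eexists; split; last reflexivity; exists (rsubmx z).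
by exists (row_mx k%:M z); rewrite E.
Qed.

(** * Short bases of the rescaled lattice and density of the returns *)

Lemma truncnSS_gt (R : realType) (x : R) : x + 1 < (Num.truncn x).+2%:R.
Proof. by rewrite -natr1 ltrD2r truncnS_gt. Qed.

(** Pigeonhole gives T^(d+1) + 1 returns with |k| <= T^(d+1) g^d and size O(1/g). At the scale h = g
    T, both k / h^d and h (k alpha + l) become O(T), uniformly in [g]. These lattice points are
    separated by [c], and a hyperplane has room for at most T^(d+1) of them. *)
Lemma flow_short_basis (R : realType) (d : nat) (B : 'M[R]_d)
    (alpha : 'rV[R]_d) :
  (0 < d)%N -> unimodular B -> badly_approximable B alpha ->
  exists (T : nat) (r : R), [/\ (0 < T)%N, 0 <= r & forall g : nat, (0 < g)%N ->
    exists p (W : 'M[R]_(p, 1 + d)),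
    [/\ forall a, lattice_of (flow_mx B alpha (g * T)) (row a W),
        forall a i, `|W a i| <= r & row_full W]].
Proof.
move=> d0 uB bad.
have [c [c0 c1 sep]] := badly_approximable_separated d0 uB bad.
pose b : R := 1 + \sum_i \sum_j `|B i j|.
have b1 : 1 <= b by rewrite lerDl sumr_ge0// => i _; rewrite sumr_ge0.
pose X : R := 2 * b / (c / d.+1%:R).
have X0 : 0 <= X by rewrite !mulr_ge0 ?invr_ge0 ?divr_ge0// ?ltW// (lt_le_trans ltr01 b1).
have XT0 (n : nat) : 0 <= X * n%:R by exact: mulr_ge0.
(* With X < q, the hyperplane bound is at most (q T)^d, and T = q^d turns this into T^(d+1), one
   less than the number of points. *)
pose q := (Num.truncn X).+2; pose T := (q ^ d)%N.
have T0 : (0 < T)%N by rewrite expn_gt0.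
have T1 : 1 <= T%:R :> R by rewrite ler1n.
exists T, (b * T%:R); split=> [//||g g0].
  by rewrite mulr_ge0// (le_trans _ b1).
have [k [l [kinj kl]]] := many_close_returns alpha (T ^ d.+1) uB g0.
set h := (g * T)%N; have h0 : (0 < h)%N by rewrite muln_gt0 g0.
have hR : 0 < h%:R :> R by rewrite ltr0n.
pose w a := row_mx ((k a)%:~R * h%:R ^- d : R)%:M
  (h%:R *: ((k a)%:~R *: alpha + l a)) : 'rV_(1 + d).
pose W := \matrix_(a, i) w a ord0 i.
have rowW a : row a W = w a by apply/rowP => i; rewrite !mxE.
have kbound a : (`|k a| <= T * h ^ d)%N.
  have [ka _ _] := kl a; rewrite (leq_trans ka)//.
  by rewrite /h expnMn expnS mulnCA mulnC !mulnA.
have Wl a : W a (lshift d ord0) = (k a)%:~R * h%:R ^- d.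
  by rewrite mxE row_mxEl mxE eqxx.
have Wr a i : W a (rshift 1 i) = h%:R * ((k a)%:~R *: alpha + l a) ord0 i.
  by rewrite mxE row_mxEr mxE.
have WT a i : `|W a i| <= b * T%:R.
  have [_ _ va] := kl a; have [i' ->|i' ->] := split_ordP i.
    rewrite (ord1 i') Wl normrM normfV [X in _ / X]ger0_norm ?exprn_ge0//.
    rewrite ler_pdivrMr ?exprn_gt0// -intr_norm -abszE.
    apply: (@le_trans _ _ (T * h ^ d)%N%:R).
      by rewrite -pmulrn ler_nat.
    by rewrite natrM natrX ler_wpM2r ?exprn_ge0// -[leLHS]mul1r ler_wpM2r.
  rewrite Wr normrM ger0_norm ?ler0n//.
  apply: (le_trans (ler_wpM2l (ler0n _ _) (va i'))).
  rewrite /h natrM [g%:R * _]mulrC -mulrA mulVKf ?pnatr_eq0 -?lt0n// mulrC.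
  by rewrite ler_wpM2r// /b lerDr.
exists (T ^ d.+1).+1, W; split => //.
  by move=> a; rewrite rowW; apply/lattice_of_flow; have [] := kl a; exists (k a), (l a).
apply: contraT => deficient.
have := @separated_rank_deficient R d _ W (b * T%:R) c c0 WT _ deficient.
have -> : 2 * (b * T%:R) / (c / d.+1%:R) = X * T%:R by rewrite /X; ring.
move=> bound; exfalso.
suff : ((T ^ d.+1).+1 <= (q * T) ^ d)%N by rewrite expnMn -expnS ltnn.
apply: leq_trans (_ : (Num.truncn (X * T%:R)).+1 ^ d <= _)%N; last first.
  rewrite leq_exp2r// truncn_lt_nat// natrM ltr_pM2r ?ltr0n//.
  by rewrite (lt_trans _ (truncnSS_gt X))// ltrDl.
apply: bound => a a' close; apply: kinj; apply/eqP/negPn/negP => /eqP kaa.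
have closel : `|(k a)%:~R * h%:R ^- d - (k a')%:~R * h%:R ^- d : R| < c.
  by rewrite -!Wl; exact: close.
(* Two rows within [c] <= 1 have first coordinates within 1, hence |k a - k a'| <= h^d, and
   separation applies to their difference. *)
have [|||i] := sep h (k a - k a') (l a - l a') h0.
- move: closel; rewrite -mulrBl -rmorphB normrM normfV [X in _ / X]ger0_norm ?exprn_ge0//.
  rewrite ltr_pdivrMr ?exprn_gt0// => lt.
  have {}lt : `|(k a - k a')%:~R : R| < h%:R ^+ d.
    by apply: lt_le_trans lt _; rewrite ger_pMl ?exprn_gt0.
  rewrite ltnW// -(@ltr_nat R) natrX; apply: le_lt_trans lt.
  by rewrite -intr_norm -abszE -pmulrn.
- by apply: lattice_ofD; [|apply: lattice_ofN]; have [] := kl a; have [] := kl a'.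
- by move=> /eqP; rewrite subr_eq0 => /eqP.
rewrite ler_pdivrMr// leNgt => /negP; apply.
have := close (rshift 1 i : 'I_(1 + d)).
rewrite !Wr -mulrBr normrM.
rewrite (gtr0_norm hR) mulrC; congr (`|_| * _ < _).
by rewrite !mxE rmorphB; ring.
Qed.

(** Let [s] be the covering radius of the rescaled lattice in the maximum norm, and approximate the
    point (s, h x). The first coordinate then lies in [0, 2 s], which makes [k] nonnegative and
    O(g^d); the others put k alpha + l within s / h of [x]. *)
Lemma returns_dense (R : realType) (d : nat) (B : 'M[R]_d)
    (alpha : 'rV[R]_d) :
  (0 < d)%N -> unimodular B -> badly_approximable B alpha ->
  exists (A : nat) (C : R), [/\ (0 < A)%N, 0 <= C &
    forall (g : nat) (x : 'rV[R]_d), (0 < g)%N ->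
    exists (k : nat) (l : 'rV[R]_d), [/\ (k <= A * g ^ d)%N, lattice_of B l &
      forall i, `|(k%:R *: alpha + l - x) ord0 i| <= C / g%:R]].
Proof.
move=> d0 uB bad; have [T [r [T0 r0 short]]] := flow_short_basis d0 uB bad.
pose s : R := (1 + d)%:R * r; have s0 : 0 <= s by rewrite mulr_ge0.
exists (Num.truncn (2 * s * T%:R ^+ d)).+1, (s / T%:R); split => //.
  by rewrite divr_ge0.
move=> g x g0; have [p [W [WG Wr full]]] := short g g0.
set h := (g * T)%N in WG; have h0 : (0 < h)%N by rewrite muln_gt0 g0.
have hR : 0 < h%:R :> R by rewrite ltr0n.
have [y /lattice_of_flow[k [l [Ll ->]]] ys] :=
  lattice_covering WG Wr full (row_mx s%:M (h%:R *: x)).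
have := ys (lshift d ord0); rewrite opp_row_mx add_row_mx.
rewrite row_mxEl !mxE eqxx !mulr1n.
rewrite -/s ler_norml => /andP[k_ge k_le].
have k0 : 0 <= k.
  by move: k_ge; rewrite lerBrDr addNr pmulr_lge0 ?invr_gt0 ?exprn_gt0// ler0z.
case: k k0 k_ge k_le ys => // k _ _ k_le ys; exists k, l; split => //.
  have k_le' : k%:R <= 2 * s * T%:R ^+ d * g%:R ^+ d.
    move: k_le; rewrite lerBlDr ler_pdivrMr ?exprn_gt0// /h natrM exprMn.
    rewrite -pmulrn => /le_trans; apply.
    by rewrite le_eqVlt; apply/orP; left; apply/eqP; ring.
  rewrite -(@ler_nat R) (le_trans k_le')// natrM natrX ler_wpM2r ?exprn_ge0//.
  by rewrite ltW// truncnS_gt.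
move=> i; have := ys (rshift 1 i).
rewrite opp_row_mx add_row_mx row_mxEr -/s.
rewrite -scalerBr mxE.
rewrite normrM (gtr0_norm hR) => le.
have -> : s / T%:R / g%:R = s / h%:R by rewrite /h natrM invfM mulrA mulrAC.
by rewrite ler_pdivlMr// mulrC.
Qed.

(** * Euclidean norm and boxes inside the cone over [D] *)

Lemma eucl_norm_ge_entry (R : realType) (d : nat) (v : 'rV[R]_d) (i : 'I_d) :
  `|v ord0 i| <= eucl_norm v.
Proof.
rewrite -sqrtr_sqr; apply: ler_wsqrtr.
by rewrite (bigD1 i)//= lerDl sumr_ge0// => j _; exact: sqr_ge0.
Qed.

Lemma eucl_norm_le_sum (R : realType) (d : nat) (v : 'rV[R]_d) :
  eucl_norm v <= \sum_i `|v ord0 i|.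
Proof.
have s0 : 0 <= \sum_i `|v ord0 i| by exact: sumr_ge0.
rewrite -[leRHS]ger0_norm// -sqrtr_sqr; apply: ler_wsqrtr.
rewrite expr2 mulr_suml; apply: ler_sum => i _.
rewrite -real_normK ?num_real// expr2 ler_wpM2l//.
by rewrite (bigD1 i)//= lerDl sumr_ge0.
Qed.

Lemma eucl_normZ (R : realType) (d : nat) (t : R) (v : 'rV[R]_d) :
  eucl_norm (t *: v) = `|t| * eucl_norm v.
Proof.
rewrite /eucl_norm -sqrtr_sqr -sqrtrM ?sqr_ge0//; congr Num.sqrt.
by rewrite mulr_sumr; apply: eq_bigr => i _; rewrite mxE exprMn.
Qed.

(** With N the norm of [w], |N - 1| <= |N^2 - 1|, and N^2 - 1 is the sum of the products (w_i -
    u_i)(w_i + u_i), each at most 3 e. Normalising therefore moves [w] only by O(e). *)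
Lemma unit_sphere_perturbation (R : realType) (d : nat) (u w : 'rV[R]_d) (e : R) :
  unit_sphere u -> 3 * d%:R * e < 1 -> e <= 1 ->
  (forall i, `|(w - u) ord0 i| <= e) ->
  0 < eucl_norm w /\
  forall i, `|((eucl_norm w)^-1 *: w - u) ord0 i| <= (3 * d%:R + 1) * e.
Proof.
move=> u1 de e1 wu; set N := eucl_norm w.
have N0 : 0 <= N by exact: sqrtr_ge0.
have N2 : N ^+ 2 = \sum_i w ord0 i ^+ 2.
  by rewrite sqr_sqrtr// sumr_ge0// => i _; exact: sqr_ge0.
have u2 : 1 = \sum_i u ord0 i ^+ 2.
  rewrite -(sqr_sqrtr (a := \sum_i _)); last by rewrite sumr_ge0// => i _; exact: sqr_ge0.
  by have := u1; rewrite /unit_sphere/= /eucl_norm => ->; rewrite expr1n.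
have N1 : `|N - 1| <= 3 * d%:R * e.
  apply: (@le_trans _ _ `|N ^+ 2 - 1|).
    rewrite subr_sqr_1 normrM ler_peMr//.
    by rewrite (le_trans _ (ler_norm _))// lerDr.
  rewrite N2 [X in _ - X]u2 -sumrB (le_trans (ler_norm_sum _ _ _))//.
  apply: (@le_trans _ _ (\sum_(i < d) 3 * e)); last first.
    by rewrite sumr_const card_ord -[_ *+ d]mulr_natl mulrA [d%:R * 3]mulrC.
  apply: ler_sum => i _; have := wu i; rewrite !mxE => wui.
  have ui : `|u ord0 i| <= 1 by rewrite -u1; exact: eucl_norm_ge_entry.
  rewrite subr_sqr normrM mulrC ler_pM//.
  by move: wui ui; rewrite !ler_norml => /andP[? ?] /andP[? ?]; apply/andP; split; lra.
have Ngt0 : 0 < N by move: N1; rewrite ler_norml => /andP[? ?]; lra.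
split => // i.
have -> : (N^-1 *: w - u) ord0 i =
    N^-1 * w ord0 i * (1 - N) + (w - u) ord0 i.
  by rewrite !mxE; field; rewrite gt_eqF.
rewrite (le_trans (ler_normD _ _))// mulrDl mul1r lerD//.
rewrite normrM distrC -[leRHS]mul1r ler_pM//.
rewrite normrM normfV (ger0_norm N0) mulrC ler_pdivrMr// mul1r.
exact: eucl_norm_ge_entry.
Qed.

(** Far enough out along an interior direction [u], a box of half-side [C] subtends a small angle,
    so it stays in the cone; dilation by [t] preserves this. *)
Lemma pos_cone_contains_boxes (R : realType) (d : nat) (D : set 'rV[R]_d) (C : R) :
  nonempty_interior_in_sphere D -> 0 <= C ->
  exists x : 'rV[R]_d, forall (t : R) (v : 'rV[R]_d), 0 < t ->
    (forall i, `|(v - t *: x) ord0 i| <= t * C) -> pos_cone D v.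
Proof.
move=> [u [e0 [e0_gt0 [u1 Du]]]] C0.
(* [P] dominates 3 d, 1 and d (3 d + 1), so e P <= min(1, e0) yields all the smallness conditions
   below. *)
pose P : R := 6 * (d%:R + 1) ^+ 2.
have dR : 0 <= d%:R :> R by [].
have P0 : 0 < P by rewrite mulr_gt0// exprn_gt0// ltr_wpDl.
pose e := Num.min 1 e0 / P.
have eP1 : e * P <= 1 by rewrite divfK ?gt_eqF// ge_min lexx.
have ePe : e * P <= e0 by rewrite divfK ?gt_eqF// ge_min lexx orbT.
have e_gt0 : 0 < e by rewrite divr_gt0// lt_min ltr01.
pose s := (C + 1) / e.
have s0 : 0 < s by rewrite divr_gt0//; lra.
exists (s *: u) => t v t0 vx; pose w := (s * t)^-1 *: v.
have st : 0 < s * t by rewrite mulr_gt0.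
have wu i : `|(w - u) ord0 i| <= e.
  have -> : w - u = (s * t)^-1 *: (v - t *: (s *: u)).
    by rewrite scalerBr !scalerA [t * s]mulrC mulVf ?gt_eqF// scale1r.
  rewrite mxE normrM normfV (gtr0_norm st) mulrC ler_pdivrMr//.
  rewrite (le_trans (vx i))// mulrA /s mulrC -subr_ge0.
  have -> : e * ((C + 1) / e) * t - C * t = t by field; rewrite gt_eqF.
  exact: ltW.
have [||N0 wN] := unit_sphere_perturbation u1 _ _ wu.
- apply: lt_le_trans eP1; rewrite mulrC ltr_pM2l// /P; nra.
- apply: le_trans eP1; rewrite -[leLHS]mulr1 ler_pM2l// /P; nra.
exists (s * t * eucl_norm w); split; first exact: mulr_gt0.
exists ((eucl_norm w)^-1 *: w); split; last first.
  by rewrite scalerA mulfK ?gt_eqF// scalerA mulfV ?scale1r// gt_eqF.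
apply: Du.
  by rewrite /unit_sphere/= eucl_normZ ger0_norm ?invr_ge0 ?ltW// mulVf// gt_eqF.
rewrite (le_lt_trans (eucl_norm_le_sum _))//; apply: lt_le_trans ePe.
apply: (@le_lt_trans _ _ (\sum_(i < d) (3 * d%:R + 1) * e)).
  by apply: ler_sum => i _; exact: wN.
rewrite sumr_const card_ord -[_ *+ d]mulr_natl mulrA mulrC ltr_pM2l// /P; nra.
Qed.

(** * Bounding [delta] and counting its values *)

(** Below [c] the set [S] is finite, so its infimum is a minimum. [F] may contain points outside
    [S], hence the filter; [c] is the default of the minimum. *)
Lemma inf_mem_seq (R : realType) (S : set R) (c : R) (F : seq R) :
  S c -> lbound S !=set0 -> (forall x, S x -> x <= c -> x \in F) -> inf S \in F.
Proof.
move=> Sc lbS SF.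
pose m := \big[Order.min/c]_(x <- F | `[< S x >]) x.
have mc : m <= c by exact: bigmin_le_id.
have Sm : S m.
  rewrite /m; elim/big_ind: _ => // [x y Sx Sy|x /asboolP//].
  by rewrite /Order.min; case: ifP.
have mS x : S x -> m <= x.
  move=> Sx; have [xc|/ltW cx] := leP x c; last exact: le_trans cx.
  by apply: ge_bigmin_seq; [exact: SF|exact/asboolP].
suff -> : inf S = m by exact: SF.
apply/eqP; rewrite eq_le; apply/andP; split; first exact: ge_inf.
by apply: lb_le_inf => //; exists c.
Qed.

Lemma badly_approximableN (R : realType) (d : nat) (B : 'M[R]_d) (alpha : 'rV[R]_d) :
  badly_approximable B alpha -> badly_approximable B (- alpha).
Proof.
move=> [c [c0 bad]]; exists c; split => // n n0 l /lattice_ofN /(bad _ n0).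
rewrite /max_norm; congr (_ < _); apply: eq_bigr => i _.
by rewrite -normrN; congr `|_|; rewrite !mxE; ring.
Qed.

Lemma delta_set_le (R : realType) (d : nat) (B : 'M[R]_d) (alpha : 'rV[R]_d)
    (D : set 'rV[R]_d) :
  (0 < d)%N -> unimodular B -> badly_approximable B alpha ->
  nonempty_interior_in_sphere D ->
  exists (A : nat) (r : R), [/\ (0 < A)%N, 0 <= r &
    forall g n N : nat, (0 < g)%N -> (2 * A * g ^ d < N)%N -> (1 <= n <= N)%N ->
    exists2 y, delta_set B alpha D n N y & y <= r / g%:R].
Proof.
move=> d0 uB bad Dint.
have [A1 [C1 [A1_gt0 C1_ge0 dense1]]] := returns_dense d0 uB bad.
have [A2 [C2 [A2_gt0 C2_ge0 dense2]]] := returns_dense d0 uB (badly_approximableN bad).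
(* The half-side C1 + C2 lets one [x] serve both directions of time. *)
have [x xD] := pos_cone_contains_boxes Dint (addr_ge0 C1_ge0 C2_ge0).
pose r := \sum_(i < d) (`|x ord0 i| + (C1 + C2)).
exists (A1 + A2)%N, r; split.
- by rewrite addn_gt0 A1_gt0.
- by rewrite sumr_ge0// => i _; rewrite !addr_ge0.
move=> g n N g0 gN /andP[n1 nN].
have gR : 0 < g%:R :> R by rewrite ltr0n.
have close v C : C <= C1 + C2 ->
    (forall i, `|(v - g%:R^-1 *: x) ord0 i| <= C / g%:R) ->
    pos_cone D v /\ eucl_norm v <= r / g%:R.
  move=> CC vx.
  have {}vx i : `|(v - g%:R^-1 *: x) ord0 i| <= g%:R^-1 * (C1 + C2).
    by rewrite (le_trans (vx i))// mulrC ler_wpM2l// invr_ge0 ltW.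
  split; first by apply: xD vx; rewrite invr_gt0.
  rewrite (le_trans (eucl_norm_le_sum _))// mulr_suml; apply: ler_sum => i _.
  have -> : v ord0 i = (v - g%:R^-1 *: x) ord0 i + g%:R^-1 * x ord0 i.
    by rewrite !mxE subrK.
  rewrite (le_trans (ler_normD _ _))// mulrDl addrC lerD//.
    by rewrite normrM normfV (gtr0_norm gR) mulrC.
  by rewrite [leRHS]mulrC.
(* Since N > 2 (A1 + A2) g^d, either m = n + k stays at most N for all k <= A1 g^d, or n exceeds A2
   g^d and m = n - k stays positive, with the returns of -alpha. *)
have [kN|nkN] := leqP (n + A1 * g ^ d) N.
  have [k [l [kA Ll kx]]] := dense1 g (g%:R^-1 *: x) g0.
  have [cone le] : pos_cone D (k%:R *: alpha + l) /\
      eucl_norm (k%:R *: alpha + l) <= r / g%:R.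
    by apply: close kx; rewrite lerDl.
  exists (eucl_norm (k%:R *: alpha + l)) => //.
  have e : (n + k)%N%:R - n%:R = k%:R :> R by rewrite natrD addrC addKr.
  by exists (n + k)%N, l; rewrite e; split => //; lia.
have [k [l [kA Ll kx]]] := dense2 g (g%:R^-1 *: x) g0.
have kn : (k < n)%N by nia.
have [cone le] : pos_cone D (k%:R *: - alpha + l) /\
    eucl_norm (k%:R *: - alpha + l) <= r / g%:R.
  by apply: close kx; rewrite lerDr.
exists (eucl_norm (k%:R *: - alpha + l)) => //.
have e : (n - k)%N%:R - n%:R = - k%:R :> R by rewrite natrB ?(ltnW kn)// addrC addKr.
by exists (n - k)%N, l; rewrite e scaleNr -scalerN; split => //; lia.
Qed.

(** Differences of returns have multipliers up to 2 N, so the returns of norm at most r / g are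
    separated at scale c / h with [h] proportional to [g]. The ratio of the two scales, hence the
    count, does not depend on [g]; the list [F] serves all [D] and [n]. *)
Lemma delta_values_in_seq (R : realType) (d : nat) (B : 'M[R]_d)
    (alpha : 'rV[R]_d) (r : R) (A : nat) :
  (0 < d)%N -> unimodular B -> badly_approximable B alpha -> (0 < A)%N ->
  exists M : nat, forall g N : nat, (0 < g)%N -> (N <= 2 * A * g.+1 ^ d)%N ->
  exists2 F : seq R, (size F <= M)%N & forall (D : set 'rV[R]_d) (n : nat) (y : R),
    (1 <= n <= N)%N -> delta_set B alpha D n N y -> y <= r / g%:R -> y \in F.
Proof.
move=> d0 uB bad A0.
have [c [c0 c1 sep]] := badly_approximable_separated d0 uB bad.
exists ((Num.truncn (16 * A%:R * r / c)).+1 ^ d)%N => g N g0 NA.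
(* Chosen so that 2 N <= 4 A (2 g)^d <= (8 A g)^d, using g + 1 <= 2 g. *)
pose h := (8 * A * g)%N; have h0 : (0 < h)%N by rewrite !muln_gt0 A0.
have hR : 0 < h%:R :> R by rewrite ltr0n.
have gR : 0 < g%:R :> R by rewrite ltr0n.
pose V : set 'rV[R]_d := [set v | exists (k : int) (l : 'rV[R]_d),
  [/\ (`|k| <= N)%N, lattice_of B l, v = k%:~R *: alpha + l &
      eucl_norm v <= r / g%:R]].
have N2 : (2 * N <= h ^ d)%N.
  apply: (@leq_trans (2 * (2 * A * (2 * g) ^ d))).
    rewrite leq_mul2l (leq_trans NA)// leq_mul2l leq_exp2r//; lia.
  have -> : h = (4 * A * (2 * g))%N by rewrite /h; lia.
  rewrite [((4 * A * _) ^ d)%N]expnMn mulnA leq_mul2r; apply/orP; right.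
  by apply: (@leq_trans ((4 * A) ^ 1)); [lia|rewrite leq_exp2l//; lia].
have [|||F sF FV] := @packing R d _ 0 V id (r / g%:R) (c / h%:R).
- by rewrite divr_gt0.
- by move=> v i [k [l [_ _ _ vr]]]; apply: le_trans vr; exact: eucl_norm_ge_entry.
- move=> v v' [k [l [kN Ll vE _]]] [k' [l' [kN' Ll' vE' _]]] close.
  apply/eqP/negPn/negP => /eqP vv.
  have [|||i] := sep h (k - k') (l - l') h0.
  + by apply: leq_trans N2; lia.
  + by apply: lattice_ofD => //; exact: lattice_ofN.
  + move=> /eqP; rewrite subr_eq0 => /eqP kk; rewrite subr_eq0.
    by apply/eqP => ll; apply: vv; rewrite vE vE' kk ll.
  rewrite leNgt => /negP; apply; have := close i.
  congr (`|_| < _); rewrite vE vE' !mxE rmorphB/=; ring.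
exists [seq eucl_norm v | v <- F].
  rewrite size_map (leq_trans sF)//.
  suff -> : 2 * (r / g%:R) / (c / h%:R) = 16 * A%:R * r / c by [].
  by rewrite /h !natrM; field; rewrite !gt_eqF// ltr0n.
move=> D n y /andP[n1 nN] [m [l [/andP[m1 mN] Ll _ ->]]] yr; apply: map_f; apply: FV.
exists (m%:Z - n%:Z), l; split => //; first by lia.
by rewrite rmorphB.
Qed.

Unset Implicit Arguments.

Theorem theorem1p6 (R : realType) (d : nat) (B : 'M[R]_d) (alpha : 'rV[R]_d)
    (D : set 'rV[R]_d) :
  (2 <= d)%N -> unimodular B -> badly_approximable B alpha ->
  D `<=` unit_sphere (d:=d) -> nonempty_interior_in_sphere D ->
  exists M : nat, forall N : nat, (1 <= N)%N -> (gN B alpha D N <= M)%N.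
Proof.
move=> d2 uB bad _ Dint; have d0 : (0 < d)%N by exact: ltn_trans d2.
have [A [r [A0 r0 below]]] := delta_set_le d0 uB bad Dint.
have [M values] := delta_values_in_seq r d0 uB bad A0.
(* For N <= 2 A there are at most N values, which the summand 2 A covers. *)
exists (2 * A + M)%N => N N1; have [NA|AN] := leqP N (2 * A).
  by rewrite (leq_trans (size_undup _))// size_map size_iota; lia.
have P1 : exists g, (2 * A * g ^ d < N)%N by exists 1%N; rewrite exp1n muln1.
have Pbound g : (2 * A * g ^ d < N)%N -> (g <= N)%N.
  move=> /ltnW; apply: leq_trans; case: g => // g.
  apply: (@leq_trans (g.+1 ^ d)); last by rewrite leq_pmull// muln_gt0.
  by rewrite -[leqLHS]expn1 leq_pexp2l.
(* For the largest [g] with 2 A g^d < N, the upper bound r / g on [delta] holds, while N <= 2 A (g +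
   1)^d makes the counting bound available at the same [g]. *)
have [g gN gmax] := ex_maxnP P1 Pbound.
have g0 : (0 < g)%N by apply: gmax; rewrite exp1n muln1.
have NA : (N <= 2 * A * g.+1 ^ d)%N.
  by rewrite leqNgt; apply/negP => /gmax; rewrite ltnn.
have [F sF FV] := values g N g0 NA.
apply: leq_trans (leq_addl _ _); apply: leq_trans sF.
apply: uniq_leq_size (undup_uniq _) _ => y; rewrite mem_undup.
move=> /mapP[n]; rewrite mem_iota add1n ltnS => nN ->.
have [c Sc cr] := below g n N g0 gN nN.
apply: (@inf_mem_seq _ _ c) => // [|y' Sy' y'c].
  by exists 0 => _ [m [l [_ _ _ ->]]]; exact: sqrtr_ge0.
by apply: FV Sy' (le_trans y'c cr).
Qed.
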